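(* For every integer $\ell\ge 2$, $\rho(\ell)=\dfrac{8}{\ell^\ell}$.
   Context: Let $U$ be a finite set, and let $\mu$ be a probability measure on the edges of the complete graph on $U$, i.e. $\mu(uv)=\mu(vu)\ge 0$ for every unordered pair $\{u,v\}\in\binom{U}{2}$ and $\sum_{\{u,v\}\in\binom{U}{2}}\mu(uv)=1$. For each $u\in U$ define its weighted degree $\mu(u)=\sum_{v\in U\setminus\{u\}}\mu(uv)$. For every integer $\ell\ge 2$ set $$\rho(\mu;\ell)=\sum_{\substack{(u_1,\ldots,u_\ell)\in U^\ell\\ u_1,\ldots,u_\ell\ \text{pairwise distinct}}}\mu(u_1)\left(\prod_{i=1}^{\ell-1}\mu(u_iu_{i+1})\right)\mu(u_\ell),$$ and define $\rho(\ell)=\sup_{U,\mu}\rho(\mu;\ell)$, where the supremum is over all finite sets $U$ and all probability measures $\mu$ on $\binom{U}{2}$. *)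

(* Defs.v *)
From mathcomp Require Import all_boot all_order all_algebra.
From mathcomp Require Import boolp classical_sets reals ereal.

Set Implicit Arguments.
Unset Strict Implicit.
Unset Printing Implicit Defensive.
Import Order.TTheory GRing.Theory Num.Theory.
Local Open Scope ring_scope.

(* A weighting of the complete graph on [U] is a function on [{set U}] of which
   only the values at the 2-element sets, i.e. at the edges, are ever used. *)
Definition edge_probability (R : realType) (U : finType) (mu : {set U} -> R)
    : Prop :=
  (forall e : {set U}, #|e| = 2%N -> 0 <= mu e) /\
  \sum_(e : {set U} | #|e| == 2%N) mu e = 1.

Definition edge_weight (R : realType) (U : finType) (mu : {set U} -> R)
    (u v : U) : R := mu [set u; v]%SET.

Definition weighted_degree (R : realType) (U : finType) (mu : {set U} -> R)
    (u : U) : R := \sum_(v : U | v != u) edge_weight mu u v.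

(* For [s = [:: u_1; ...; u_l]], [pairmap] lists the weights of the l - 1
   consecutive pairs of [s]; the value at the empty sequence is irrelevant. *)
Definition walk_weight (R : realType) (U : finType) (mu : {set U} -> R)
    (s : seq U) : R :=
  if s is u :: s' then
    weighted_degree mu u
    * (\prod_(w <- pairmap (edge_weight mu) u s') w)
    * weighted_degree mu (last u s')
  else 0.

Definition rho_of (R : realType) (U : finType) (mu : {set U} -> R) (l : nat)
    : R :=
  \sum_(t : l.-tuple U | uniq t) walk_weight mu t.

(* The supremum is taken in the extended reals, so that no boundedness
   is presupposed. *)
Definition rho (R : realType) (l : nat) : \bar R :=
  ereal_sup [set x : \bar R | exists (U : finType) (mu : {set U} -> R),
    edge_probability mu /\ x = (rho_of mu l)%:E]%classic.

(* Main.v *)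
Require Import Defs.
From mathcomp Require Import all_boot all_order all_algebra.
From mathcomp Require Import boolp classical_sets reals ereal.
From mathcomp Require Import ring.
(** The upper bound rests on one observation: the two end degrees of a path can
be decoupled.  Write d for the weighted degree.  For a path u_1, ..., u_l,
  d(u_1) d(u_l) <= (d(u_1)^2 + d(u_l)^2) / 2,
and reversing paths exchanges the two squares, so [rho_of] is at most the sum
over u of d(u)^2 times the total weight of the paths with l vertices that start
at u (the weight of a path being the product of its edge weights).

A path can be read as a self-avoiding walk that removes the star of each vertex
it leaves.  The stars removed successively are disjoint, hence share a total
weight of at most 1, and the AM-GM inequality bounds the sum of all walks of n
steps from a given vertex in a graph of total weight W by (W / n)^n; keeping the
first star apart sharpens this ([walk_sum_le]).  That star weighs exactly d(u),
so the paths starting at u weigh at most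
d(u) ((1 - d(u)) / (l - 2))^(l - 2).  A second use of AM-GM, on two factors
d(u) / 2 and l - 2 factors (1 - d(u)) / (l - 2), whose sum is 1, gives
  d(u)^2 ((1 - d(u)) / (l - 2))^(l - 2) <= 4 / l^l
([degree_walk_sum_le]).  One factor d(u) is left over, and the degrees sum to 2,
whence the bound 8 / l^l ([rho_of_le]).

The bound is attained by the uniform measure on the cycle of length l when
l >= 3: all degrees are 2 / l and each of the 2 l arcs with l vertices weighs
l^-(l - 1) ([rho_of_cycle]).  For l = 2 it is attained by a single edge of
weight 1 ([rho_of_single_edge]). *)

Set Implicit Arguments.
Unset Strict Implicit.
Unset Printing Implicit Defensive.
Import Order.TTheory GRing.Theory Num.Theory.
Local Open Scope ring_scope.

(** * Edges at a vertex *)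

Lemma sum_edges_at (R : realType) (U : finType) (P : pred {set U})
    (F : {set U} -> R) (u : U) :
  \sum_(e : {set U} | [&& #|e| == 2%N, u \in e & P e]) F e
  = \sum_(v : U | (v != u) && P [set u; v]%SET) F [set u; v]%SET.
Proof.
pose A := [set v : U | (v != u) && P [set u; v]%SET]%SET.
pose h (v : U) := [set u; v]%SET.
have hI : {in A &, injective h}.
  move=> v w; rewrite !inE => /andP[vu _] _ /setP /(_ v).
  by rewrite !inE eqxx orbT (negPf vu) => /esym/eqP.
have -> : \sum_(v | (v != u) && P [set u; v]%SET) F [set u; v]%SET
    = \sum_(v in A) F (h v) by apply: eq_bigl => v; rewrite inE.
rewrite -(big_imset F hI); apply: eq_bigl => e; apply/idP/imsetP.
- case/and3P=> /cards2P[x [y [xy ->]]]; rewrite !inE.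
  case/orP=> /eqP ux; move: xy; rewrite -ux => xy Pe; [exists y | exists x] => //.
  + by rewrite inE eq_sym xy.
  + by rewrite inE xy finset.setUC.
  + by rewrite /h finset.setUC.
- case=> v; rewrite inE => /andP[vu Pv] ->.
  by rewrite cards2 [u == v]eq_sym vu set21 Pv.
Qed.

Definition star_weight (R : realType) (U : finType) (mu : {set U} -> R)
    (T : {set U}) (u : U) : R := \sum_(v : U | v \notin T) edge_weight mu u v.

Definition weight_avoiding (R : realType) (U : finType) (mu : {set U} -> R)
    (T : {set U}) : R :=
  \sum_(e : {set U} | (#|e| == 2%N) && [disjoint e & T]) mu e.

(** In applications [u \in T]: the set [T] contains all the vertices that the walk
must not visit again, its current position [u] included. *)
Definition walk_sum (R : realType) (U : finType) (mu : {set U} -> R)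
    (n : nat) (T : {set U}) (u : U) : R :=
  \sum_(t : n.-tuple U | uniq t && all [predC T] t)
    \prod_(w <- pairmap (edge_weight mu) u t) w.

(** When a walk moves to [u], the edges it can still use are those at [u], from
which the next step is taken, and those that avoid [u] as well.  Iterating this
identity shows that the stars used along a walk share the total weight. *)
Lemma weight_avoidingD1 (R : realType) (U : finType) (mu : {set U} -> R)
    (T : {set U}) (u : U) : u \notin T ->
  weight_avoiding mu T
  = star_weight mu (u |: T)%SET u + weight_avoiding mu (u |: T)%SET.
Proof.
move=> uT; rewrite /weight_avoiding (bigID (fun e : {set U} => u \in e)) /=.
congr (_ + _).
- rewrite /star_weight /edge_weight.
  rewrite (eq_bigl (fun e : {set U} =>
    [&& #|e| == 2%N, u \in e & [disjoint e & T]])); last first.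
    by move=> e; rewrite -andbA [X in _ && X]andbC.
  rewrite (sum_edges_at (fun e : {set U} => [disjoint e & T])).
  by apply: eq_bigl => v;
    rewrite finset.disjoints_subset finset.subUset !finset.sub1set !inE uT negb_or.
- apply: eq_bigl => e; rewrite -andbA; congr (_ && _).
  by rewrite ![[disjoint e & _]]disjoint_sym !finset.disjoints_subset
    finset.subUset finset.sub1set inE andbC.
Qed.

Lemma weighted_degreeE (R : realType) (U : finType) (mu : {set U} -> R) (u : U) :
  weighted_degree mu u = \sum_(e : {set U} | (#|e| == 2%N) && (u \in e)) mu e.
Proof.
rewrite (eq_bigl (fun e : {set U} => [&& #|e| == 2%N, u \in e & predT e])).
  by rewrite sum_edges_at; apply: eq_bigl => v; rewrite andbT.
by move=> e; rewrite andbT.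
Qed.

Lemma sum_weighted_degree (R : realType) (U : finType) (mu : {set U} -> R) :
  \sum_u weighted_degree mu u = 2 * \sum_(e : {set U} | #|e| == 2%N) mu e.
Proof.
under eq_bigr => u _ do rewrite weighted_degreeE.
rewrite (exchange_big_dep (fun e : {set U} => #|e| == 2%N)) /=; last first.
  by move=> u e _ /andP[].
rewrite mulr_sumr; apply: eq_bigr => e e2.
by rewrite e2 sumr_const (eqP e2) mulr_natl.
Qed.

(** * Sums over self-avoiding walks *)

Lemma sum_tuple_cons (R : realType) (U : finType) (n : nat)
    (P : pred (seq U)) (F : seq U -> R) :
  \sum_(t : n.+1.-tuple U | P t) F t
  = \sum_(u : U) \sum_(t : n.-tuple U | P (u :: t)) F (u :: t).
Proof.
rewrite pair_big_dep /=.
rewrite (reindex (fun p : U * n.-tuple U => [tuple of p.1 :: p.2])) //=.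
exists (fun t => (thead t, [tuple of behead t])).
- by case=> u t _; rewrite /= theadE; congr pair; apply: val_inj.
- by move=> t _; rewrite -tuple_eta.
Qed.

Lemma walk_sum0 (R : realType) (U : finType) (mu : {set U} -> R)
    (T : {set U}) (u : U) : walk_sum mu 0 T u = 1.
Proof.
rewrite /walk_sum (big_pred1 [tuple]) ?big_nil //.
by move=> t; rewrite (tuple0 t) /= eqxx.
Qed.

Lemma walk_sumS (R : realType) (U : finType) (mu : {set U} -> R)
    (n : nat) (T : {set U}) (u : U) :
  walk_sum mu n.+1 T u
  = \sum_(v | v \notin T) edge_weight mu u v * walk_sum mu n (v |: T)%SET v.
Proof.
rewrite /walk_sum (sum_tuple_cons n (fun s => uniq s && all [predC T] s)
  (fun s => \prod_(w <- pairmap (edge_weight mu) u s) w)) /=.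
rewrite [LHS](bigID (fun v => v \notin T)) /= [X in _ + X]big1 ?addr0; last first.
  move=> v; rewrite negbK => vT; rewrite big_pred0 // => t.
  by rewrite vT /= !andbF.
apply: eq_bigr => v vT; rewrite mulr_sumr; apply: eq_big => [t|t _].
  rewrite vT /=.
  have -> : all [predC (v |: T)%SET] t = (v \notin (t : seq U)) && all [predC T] t.
    rewrite -has_pred1 -all_predC -all_predI; apply: eq_all => w.
    by rewrite /= !inE negb_or.
  by rewrite andbCA andbA.
by rewrite big_cons.
Qed.

(** * The upper bound *)

Lemma weighted_amgm (R : realType) (p q : nat) (a b : R) :
  0 <= a -> 0 <= b ->
  a ^+ p * b ^+ q <= ((a *+ p + b *+ q) / (p + q)%:R) ^+ (p + q).
Proof.
move=> a0 b0.
pose E (i : 'I_p + 'I_q) := if i is inl _ then a else b.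
have E0 : {in predT, forall i, 0 <= E i} by case.
have [+ _] := leif_AGM E0.
by rewrite !big_sumType /= !prodr_const !sumr_const cardT
  -cardE card_sum !card_ord.
Qed.

Lemma edge_weight_ge0 (R : realType) (U : finType) (mu : {set U} -> R) :
  edge_probability mu -> forall u v, u != v -> 0 <= edge_weight mu u v.
Proof. by case=> mu0 _ u v uv; apply: mu0; rewrite cards2 uv. Qed.

Lemma star_weight_ge0 (R : realType) (U : finType) (mu : {set U} -> R)
   (T : {set U}) (u : U) :
  edge_probability mu -> u \in T -> 0 <= star_weight mu T u.
Proof.
move=> hmu uT; apply: sumr_ge0 => v vT; apply: edge_weight_ge0 => //.
by apply: contraNneq vT => <-.
Qed.

Lemma weight_avoiding_ge0 (R : realType) (U : finType) (mu : {set U} -> R)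
   (T : {set U}) : edge_probability mu -> 0 <= weight_avoiding mu T.
Proof. by case=> mu0 _; apply: sumr_ge0 => e /andP[/eqP/mu0]. Qed.

(** The first step spends the star of [u] and leaves a walk of [n] steps in the
graph that avoids [T].  From the next vertex [v], induction bounds what remains
by a product of the star of [v] and [n - 1] equal factors, whose sum is at most
the weight avoiding [T]; AM-GM then makes all [n] factors equal.  For [n = 0] the
power is [1] although its base is a division by zero. *)
Lemma walk_sum_le (R : realType) (U : finType) (mu : {set U} -> R)
    (n : nat) (T : {set U}) (u : U) :
  edge_probability mu -> u \in T ->
  walk_sum mu n.+1 T u
  <= star_weight mu T u * (weight_avoiding mu T / n%:R) ^+ n.
Proof.
move=> hmu; elim: n T u => [|n IHn] T u uT; rewrite walk_sumS mulr_suml.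
  by apply: ler_sum => v _; rewrite walk_sum0 expr0.
apply: ler_sum => v vT; apply: ler_wpM2l.
  by apply: edge_weight_ge0 => //; apply: contraNneq vT => <-.
have vT' : v \in (v |: T)%SET by rewrite setU11.
apply: le_trans (IHn _ _ vT') _; rewrite (weight_avoidingD1 mu vT).
set a := star_weight _ _ _; set b := weight_avoiding _ _.
have a0 : 0 <= a by apply: star_weight_ge0.
have b0 : 0 <= b by apply: weight_avoiding_ge0.
have := @weighted_amgm R 1 n a (b / n%:R) a0 (divr_ge0 b0 (ler0n _ _)).
rewrite expr1 mulr1n add1n => /le_trans; apply.
apply: lerXn2r; rewrite ?nnegrE.
- by rewrite divr_ge0 // addr_ge0 // mulrn_wge0 // divr_ge0.
- by rewrite divr_ge0 // addr_ge0.
rewrite ler_wpM2r ?invr_ge0 // lerD2l.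
case: n {IHn} => [|n]; first by rewrite mulr0n.
by rewrite -[leLHS]mulr_natr divfK ?pnatr_eq0.
Qed.

(** With d = [weighted_degree mu u], the remaining weight is 1 - d, and AM-GM is
applied to two factors d / 2 and [n] factors (1 - d) / n, whose sum is 1.  The
factor d on the right is the weight of the first step: it is kept so that the
bound can be summed over [u], the degrees having sum 2. *)
Lemma degree_walk_sum_le (R : realType) (U : finType) (mu : {set U} -> R)
    (n : nat) (u : U) : edge_probability mu ->
  weighted_degree mu u ^+ 2 * walk_sum mu n.+1 [set u]%SET u
  <= 4 / n.+2%:R ^+ n.+2 * weighted_degree mu u.
Proof.
move=> hmu.
have dE : weighted_degree mu u = star_weight mu [set u]%SET u.
  by apply: eq_bigl => v; rewrite inE.
have uu : u \in [set u]%SET by rewrite inE.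
have d0 : 0 <= weighted_degree mu u by rewrite dE star_weight_ge0.
have := walk_sum_le n hmu uu; rewrite -dE.
set d := weighted_degree mu u in dE d0 *; set b := weight_avoiding _ _ => le_w.
have b0 : 0 <= b by apply: weight_avoiding_ge0.
have db : d + b = 1.
  rewrite dE; have [_ <-] := hmu.
  have := @weight_avoidingD1 R U mu finset.set0 u; rewrite inE finset.setU0.
  move=> /(_ isT) <-.
  apply: eq_bigl => e.
  by rewrite finset.disjoints_subset finset.setC0 finset.subsetT andbT.
apply: le_trans (ler_wpM2l (exprn_ge0 2 d0) le_w) _.
rewrite mulrCA mulrC ler_wpM2r //.
have := @weighted_amgm R 2 n (d / 2) (b / n%:R) _ _.
rewrite !divr_ge0 // => /(_ isT isT) amgm.
have {amgm} : (d / 2) ^+ 2 * (b / n%:R) ^+ n <= (1 / n.+2%:R) ^+ n.+2.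
  apply: le_trans amgm _; rewrite add2n.
  apply: lerXn2r; rewrite ?nnegrE ?divr_ge0 //.
    by rewrite addr_ge0 // mulrn_wge0 // divr_ge0.
  rewrite ler_wpM2r ?invr_ge0 // -[leRHS]db.
  have -> : (d / 2) *+ 2 = d by rewrite -[LHS]mulr_natr divfK ?pnatr_eq0.
  rewrite lerD2l; case: n {le_w} => [|n]; first by rewrite mulr0n.
  by rewrite -[leLHS]mulr_natr divfK ?pnatr_eq0.
set x := (b / _) ^+ n => amgm.
have -> : d ^+ 2 * x = 4 * ((d / 2) ^+ 2 * x) by field.
by rewrite ler_wpM2l // (le_trans amgm) // expr_div_n expr1n div1r.
Qed.

Lemma edge_weightC (R : realType) (U : finType) (mu : {set U} -> R) (u v : U) :
  edge_weight mu u v = edge_weight mu v u.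
Proof. by rewrite /edge_weight finset.setUC. Qed.

(** The path [u :: s] read backwards starts at [last u s] and continues with
[rev (belast u s)]. *)
Lemma prod_edge_weight_rev (R : realType) (U : finType) (mu : {set U} -> R)
    (u : U) (s : seq U) :
  \prod_(w <- pairmap (edge_weight mu) (last u s) (rev (belast u s))) w
  = \prod_(w <- pairmap (edge_weight mu) u s) w.
Proof.
elim: s u => [|v s IHs] u //=.
rewrite rev_cons -cats1 pairmap_cat big_cat IHs big_cons /= big_seq1 mulrC.
congr (_ * _); rewrite edge_weightC; congr edge_weight.
case/lastP: s {IHs} => [|s w] //=.
by rewrite belast_rcons rev_cons last_rcons.
Qed.

Lemma prod_edge_weight_ge0 (R : realType) (U : finType) (mu : {set U} -> R)
    (u : U) (s : seq U) : edge_probability mu -> uniq (u :: s) ->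
  0 <= \prod_(w <- pairmap (edge_weight mu) u s) w.
Proof.
move=> hmu; elim: s u => [|v s IHs] u; first by rewrite big_nil.
rewrite big_cons => /andP[uvs /IHs]; apply: mulr_ge0.
by apply: edge_weight_ge0 => //; apply: contraNneq uvs => ->; rewrite mem_head.
Qed.

Lemma sum_tuple_rev (R : realType) (U : finType) (n : nat) (F : seq U -> R) :
  \sum_(t : n.-tuple U | uniq t) F (rev t) = \sum_(t : n.-tuple U | uniq t) F t.
Proof.
have revI : injective (fun t : n.-tuple U => [tuple of rev t]).
  by move=> s t /(congr1 val) /= /(can_inj revK); apply: val_inj.
rewrite [RHS](reindex_inj revI) /=.
by apply: eq_bigl => t; rewrite rev_uniq.
Qed.

(** Replacing the product of the two end degrees by the mean of their squares
costs nothing at the optimum, where the degrees are equal, and reversal of paths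
turns both squares into the square of the initial degree. *)
Lemma rho_of_le (R : realType) (U : finType) (mu : {set U} -> R) (n : nat) :
  edge_probability mu -> rho_of mu n.+2 <= 8 / n.+2%:R ^+ n.+2.
Proof.
move=> hmu.
(* [F] is the path weight with both end degrees replaced by the initial one. *)
pose F (s : seq U) : R := if s is u :: s' then
  weighted_degree mu u ^+ 2 * \prod_(w <- pairmap (edge_weight mu) u s') w else 0.
have sumF : \sum_(t : n.+2.-tuple U | uniq t) F t <= 8 / n.+2%:R ^+ n.+2.
  rewrite sum_tuple_cons /=.
  have -> : 8 / n.+2%:R ^+ n.+2
      = \sum_u 4 / n.+2%:R ^+ n.+2 * weighted_degree mu u.
    by rewrite -mulr_sumr sum_weighted_degree (proj2 hmu); ring.
  apply: ler_sum => u _; apply: le_trans (degree_walk_sum_le n u hmu).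
  rewrite -mulr_sumr le_eqVlt; apply/orP; left; apply/eqP; congr (_ * _).
  apply: eq_bigl => t; rewrite andbC; congr (_ && _).
  by rewrite -has_pred1 -all_predC; apply: eq_all => w; rewrite /= !inE.
suff : rho_of mu n.+2 *+ 2 <= (\sum_(t : n.+2.-tuple U | uniq t) F t) *+ 2.
  by rewrite ler_pMn2r // => /le_trans; apply.
rewrite -sumrMnl mulr2n -{2}sum_tuple_rev -big_split /=.
apply: ler_sum => t; case: (t : seq U) => [|u s] us; first by rewrite mul0rn addr0.
rewrite lastI rev_rcons /= prod_edge_weight_rev -lastI /= -mulrDl.
have P0 := prod_edge_weight_ge0 hmu us.
set d := weighted_degree mu u; set d' := weighted_degree mu (last u s).
rewrite -subr_ge0 [leRHS](_ : _ = (d - d') ^+ 2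
  * \prod_(w <- pairmap (edge_weight mu) u s) w); last by ring.
by rewrite mulr_ge0 // sqr_ge0.
Qed.

(** * Cycles attain the bound *)

Lemma walk_weight_ge0 (R : realType) (U : finType) (mu : {set U} -> R)
    (s : seq U) : edge_probability mu -> uniq s -> 0 <= walk_weight mu s.
Proof.
move=> hmu; case: s => [|u s] us //=.
have d0 v : 0 <= weighted_degree mu v.
  by apply: sumr_ge0 => w wv; apply: edge_weight_ge0; rewrite // eq_sym.
by rewrite !mulr_ge0 ?d0 // prod_edge_weight_ge0.
Qed.

(** Lower bounds come from exhibiting distinct paths, since no path has a negative
weight. *)
Lemma rho_of_ge (R : realType) (U I : finType) (mu : {set U} -> R) (n : nat)
    (f : I -> n.-tuple U) (c : R) :
  edge_probability mu -> injective f -> (forall i, uniq (f i)) ->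
  (forall i, c <= walk_weight mu (f i)) -> c *+ #|I| <= rho_of mu n.
Proof.
move=> hmu fI fU fc; rewrite /rho_of (bigID (mem (codom f))) /= -[leLHS]addr0.
apply: lerD; last first.
  by apply: sumr_ge0 => t /andP[ut _]; apply: walk_weight_ge0.
rewrite (eq_bigl (mem (f @: predT)%SET)); last first.
  move=> t; apply/andP/imsetP => [[_ /codomP[i ->]]|[i _ ->]].
    by exists i.
  by rewrite fU codom_f.
rewrite big_imset /=; last by move=> i j _ _; apply: fI.
by rewrite -sumr_const ler_sum.
Qed.

(** Counting the indices [j] of an edge, instead of testing that one exists, makes
the total weight and the degrees computable by exchanging two sums. *)
Definition cycle_measure (R : realType) (n : nat) (e : {set 'I_n.+3}) : R :=
  (\sum_(j : 'I_n.+3) (e == [set j; j + 1]%SET)%:R) / n.+3%:R.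

Lemma cycle_step_neq (n : nat) (j : 'I_n.+3) : j != j + 1.
Proof. by rewrite -subr_eq0 opprD addrA subrr add0r oppr_eq0. Qed.

Lemma cycle_measure_probability (R : realType) (n : nat) :
  edge_probability (@cycle_measure R n).
Proof.
split=> [e _|]; first by rewrite divr_ge0 // sumr_ge0.
rewrite -mulr_suml exchange_big /=.
rewrite (eq_bigr (fun _ => 1)).
  by rewrite sumr_const card_ord divff // pnatr_eq0.
move=> j _; rewrite (bigD1 [set j; j + 1]%SET) ?cards2 ?cycle_step_neq //=.
by rewrite eqxx big1 ?addr0 // => e /andP[_ /negPf->].
Qed.

Lemma cycle_measure_edge (R : realType) (n : nat) (j : 'I_n.+3) :
  n.+3%:R^-1 <= edge_weight (@cycle_measure R n) j (j + 1).
Proof.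
rewrite /edge_weight /cycle_measure ler_pdivlMr ?ltr0n // mulVf ?pnatr_eq0 //.
by rewrite (bigD1 j) //= eqxx lerDl sumr_ge0.
Qed.

Lemma cycle_measure_degree (R : realType) (n : nat) (i : 'I_n.+3) :
  weighted_degree (@cycle_measure R n) i = 2 / n.+3%:R.
Proof.
rewrite weighted_degreeE -mulr_suml exchange_big /=; congr (_ / _).
transitivity (\sum_(j : 'I_n.+3) ((j == i)%:R + (j == i - 1)%:R) : R).
  apply: eq_bigr => j _.
  rewrite (big_mkcond (fun e : {set 'I_n.+3} => (#|e| == 2%N) && (i \in e))) /=.
  rewrite (bigD1 [set j; j + 1]%SET) //= big1 ?addr0; last first.
    by move=> e /negPf->; rewrite if_same.
  rewrite eqxx cards2 cycle_step_neq !inE eq_sym -(subr_eq i).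
  rewrite [i - 1 == j]eq_sym.
  have [->|_] := eqVneq j i; last by rewrite add0r; case: (j == i - 1).
  by rewrite [i == i - 1]eq_sym subr_eq (negPf (cycle_step_neq i)) addr0.
have sum1 k : \sum_(j : 'I_n.+3) (j == k)%:R = 1 :> R.
  by rewrite (bigD1 k) //= eqxx big1 ?addr0 // => j /negPf->.
by rewrite big_split /= !sum1.
Qed.

(** The arcs of the cycle are traversed in the directions 1 and -1, which differ
as the length is at least 3. *)
Definition cycle_dir (n : nat) (b : bool) : 'I_n.+3 := if b then 1 else -1.

Lemma cycle_measure_step (R : realType) (n : nat) (b : bool) (i : 'I_n.+3) :
  n.+3%:R^-1 <= edge_weight (@cycle_measure R n) i (i + cycle_dir n b).
Proof.
case: b => /=; first exact: cycle_measure_edge.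
by rewrite edge_weightC -{2}[i](subrK 1) cycle_measure_edge.
Qed.

Definition cycle_walk (n : nat) (p : 'I_n.+3 * bool) : seq 'I_n.+3 :=
  traject (fun i => i + cycle_dir n p.2) p.1 n.+3.

Lemma size_cycle_walk (n : nat) (p : 'I_n.+3 * bool) :
  size (cycle_walk p) == n.+3.
Proof. by rewrite size_traject. Qed.

Lemma cycle_walk_uniq (n : nat) (p : 'I_n.+3 * bool) : uniq (cycle_walk p).
Proof.
have itE k : iter k (fun i => i + cycle_dir n p.2) p.1
    = p.1 + cycle_dir n p.2 *+ k.
  by elim: k => [|k IHk]; rewrite ?addr0 //= IHk mulrSr addrA.
apply/(uniqP p.1) => j k; rewrite !inE size_traject => jn kn.
rewrite !nth_traject // !itE => /addrI.
have {}itE m : (m < n.+3)%N -> (m%:R : 'I_n.+3) = m :> nat.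
  by move=> mn; rewrite Zp_nat /= modn_small.
case: p.2; last rewrite !mulNrn => /oppr_inj.
  by move=> /(congr1 val) /=; rewrite !itE.
by move=> /(congr1 val) /=; rewrite !itE.
Qed.

Lemma cycle_walk_inj (n : nat) : injective (@cycle_walk n).
Proof.
move=> [i b] [j c] eq_ij.
have /= ij := congr1 (head 0) eq_ij.
have /= := congr1 (head 0 \o behead) eq_ij.
have opp1 : (1 : 'I_n.+3) <> -1.
  by move/(congr1 val); rewrite /= !modn_small.
by rewrite -ij => /addrI; case: b c {eq_ij} => [] [] //= e; case: opp1.
Qed.

Lemma cycle_walk_weight (R : realType) (n : nat) (p : 'I_n.+3 * bool) :
  4 / n.+3%:R ^+ n.+4 <= walk_weight (@cycle_measure R n) (cycle_walk p).
Proof.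
case: p => i b; rewrite /cycle_walk trajectS /walk_weight !cycle_measure_degree.
have prod_ge m k : n.+3%:R^-1 ^+ m <= \prod_(w <- pairmap
    (edge_weight (@cycle_measure R n)) k
    (traject (fun i => i + cycle_dir n b) (k + cycle_dir n b) m)) w.
  elim: m k => [|m IHm] k; first by rewrite big_nil.
  rewrite trajectS /= big_cons exprS.
  by apply: ler_pM; rewrite ?cycle_measure_step ?IHm ?exprn_ge0 ?invr_ge0.
(* two end degrees 2 / l and n + 2 = l - 1 edges of weight at least 1 / l *)
have -> : 4 / n.+3%:R ^+ n.+4
    = 2 / n.+3%:R * n.+3%:R^-1 ^+ n.+2 * (2 / n.+3%:R) :> R.
  by rewrite mulrAC mulf_div -natrM -expr2 exprVn -mulrA -invfM -exprD add2n.
by rewrite !(ler_wpM2r, ler_wpM2l) ?divr_ge0.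
Qed.

Lemma rho_of_cycle (R : realType) (n : nat) :
  8 / n.+3%:R ^+ n.+3 <= rho_of (@cycle_measure R n) n.+3.
Proof.
pose f p : n.+3.-tuple 'I_n.+3 := Tuple (size_cycle_walk p).
have fI : injective f by move=> p q /(congr1 val) /cycle_walk_inj.
apply: le_trans (rho_of_ge (cycle_measure_probability R n) fI
  (@cycle_walk_uniq n) (@cycle_walk_weight R n)).
rewrite card_prod card_ord card_bool -[leRHS]mulr_natr natrM.
rewrite le_eqVlt; apply/orP; left; apply/eqP.
have n0 : n.+3%:R != 0 :> R by rewrite pnatr_eq0.
have {n0} [x0 y0] := (n0, expf_neq0 n.+3 n0).
by rewrite [in RHS]exprS; move: _%:R (_ ^+ _) x0 y0 => x y x0 y0; field; rewrite y0.
Qed.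

(** For paths with two vertices the cycle degenerates to one edge, and its two
directions to the same one. *)
Lemma single_edge_probability (R : realType) :
  edge_probability (fun _ : {set 'I_2} => 1 : R).
Proof.
split=> //; rewrite sumr_const -cardsE card_draws card_ord.
by [].
Qed.

Lemma rho_of_single_edge (R : realType) :
  rho_of (fun _ : {set 'I_2} => 1 : R) 2 = 2.
Proof.
have d1 u : weighted_degree (fun _ : {set 'I_2} => 1 : R) u = 1.
  by rewrite /weighted_degree sumr_const cardC1 card_ord.
rewrite /rho_of (eq_bigr (fun _ => 1)) => [|t _].
  rewrite sumr_const -[2]/(2 ^_ 2)%:R; congr _%:R.
  have := card_uniq_tuples 2 (@predT 'I_2); rewrite card_ord => <-.
  by rewrite cardsE; apply: eq_card => t; rewrite [RHS]unfold_in all_predT.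
case/tupleP: t => u t; case/tupleP: t => v t; rewrite (tuple0 t) /= !d1.
by rewrite big_seq1 !mulr1.
Qed.

Theorem theorem1p3 (R : realType) (l : nat) (hl : (2 <= l)%N) :
  rho R l = (8 / l%:R ^+ l)%:E.
Proof.
apply/eqP; rewrite eq_le; apply/andP; split.
  apply: ge_ereal_sup => _ [U [mu [hmu ->]]]; rewrite lee_fin.
  by case: l hl => [|[|n]] // _; apply: rho_of_le.
case: l hl => [|[|[|n]]] // _.
  apply: ereal_sup_ubound; exists 'I_2, (fun _ => 1).
  split; first exact: single_edge_probability.
  by rewrite rho_of_single_edge; congr (_%:E); field.
apply: le_trans (ereal_sup_ubound _); last first.
  by exists 'I_n.+3, (@cycle_measure R n); split; first exact: cycle_measure_probability.
by rewrite lee_fin rho_of_cycle.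
Qed.
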